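(* Let $K\subset\mathbb{R}^n$ be a nonempty compact set and let $\lambda$ be a finite Borel measure whose support is exactly $K$ (for instance the restriction of the Lebesgue measure to $K=[-1,1]^n$). Let $f,g\in\mathbb{R}[x_1,\dots,x_n]$ with $g>0$ on $K$, and let $\rho:=\min_{x\in K} f(x)/g(x)$. Let $U:K\to\mathbb{R}^2$, $U(x)=(f(x),g(x))$, let $U_\#\lambda$ be the pushforward of $\lambda$ by $U$, and let $y^\#=(y^\#_{i,j})_{(i,j)\in\mathbb{N}^2}$ be its moment sequence, i.e. $y^\#_{i,j}=\int u^iv^j\,dU_\#\lambda(u,v)=\int_K f(x)^i g(x)^j\,d\lambda(x)$. For $d\in\mathbb{N}$ consider the semidefinite program $$a_d^\#=\sup_{a\in\mathbb{R}}\{\,a:\ M_d(u\,y^\#)\succeq a\,M_d(v\,y^\#)\,\}\qquad (P_d)$$ and the semidefinite program $$\rho_d^\#=\inf_{\sigma\in\Sigma[u,v]_d}\Big\{\int u\,\sigma(u,v)\,dU_\#\lambda(u,v):\ \int v\,\sigma(u,v)\,dU_\#\lambda(u,v)=1\Big\}.\qquad (D_d)$$ Then: (i) For every $d\in\mathbb{N}$, $(P_d)$ has an optimal solution $a_d^\#\ge\rho$. (ii) For every $d\in\mathbb{N}$, there is no duality gap between $(D_d)$ and $(P_d)$, i.e. $\rho_d^\#=a_d^\#$, and $(D_d)$ has an optimal solution $\sigma^\star\in\Sigma[u,v]_d$. (iii) The sequence $(a_d^\#)_{d\in\mathbb{N}}$ is monotone nonincreasing and $a_d^\#\downarrow\rho$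 as $d\to\infty$.
   Context: $\Sigma[u,v]_d$ is the set of polynomials in the two variables $(u,v)$ of degree at most $2d$ that are finite sums of squares of real polynomials. For a real sequence $z=(z_\alpha)_{\alpha\in\mathbb{N}^m}$, let $L_z:\mathbb{R}[x_1,\dots,x_m]\to\mathbb{R}$ be the Riesz linear functional $L_z(\sum_\alpha p_\alpha x^\alpha)=\sum_\alpha p_\alpha z_\alpha$. For a polynomial $p$ and $d\in\mathbb{N}$, the localizing matrix $M_d(p\,z)$ is the real symmetric matrix with rows and columns indexed by $\alpha,\beta\in\mathbb{N}^m$ with $|\alpha|=\sum_i\alpha_i\le d$, $|\beta|\le d$, and entries $M_d(p\,z)(\alpha,\beta)=L_z(p(x)\,x^{\alpha+\beta})$. Here $m=2$, the variables are $(u,v)$, and $p$ is the monomial $u$ or $v$. $A\succeq B$ means that $A-B$ is positive semidefinite. The pushforward is $U_\#\lambda(C)=\lambda(U^{-1}(C))$ for Borel $C\subset\mathbb{R}^2$. *)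

(* Defs.v *)
From HB Require Import structures.
From mathcomp Require Import all_boot all_order all_algebra.
(* The notations of mpoly clash with those of MathComp-Analysis: polynomials in
   n variables over R are written [mpoly n R]. *)
From mathcomp.multinomials Require Import -(notations) mpoly.
From mathcomp Require Import all_classical all_reals all_analysis.

Set Implicit Arguments.
Unset Strict Implicit.
Unset Printing Implicit Defensive.

Import Order.TTheory GRing.Theory Num.Theory.
Import numFieldNormedType.Exports.

Local Open Scope classical_set_scope.
Local Open Scope ring_scope.

(* R^n with its Borel sigma-algebra. *)
Definition borelRn (R : realType) (n : nat) :=
  g_sigma_algebraType (@open 'rV[R]_n).

Definition evalp (R : realType) (n : nat) (p : mpoly n R) (x : 'rV[R]_n) : R :=
  meval (x ord0) p.

Definition msupport (R : realType) (n : nat)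
    (mu : {measure set (borelRn R n) -> \bar R}) : set 'rV[R]_n :=
  [set x | forall V : set 'rV[R]_n, open V -> V x -> (0 < mu V)%E].

Lemma compact_borel (R : realType) (n : nat) (K : set 'rV[R]_n) :
  compact K -> measurable (K : set (borelRn R n)).
Proof.
move=> cK; rewrite -[K]setCK; apply: measurableC; apply: sub_sigma_algebra.
by apply: closed_openC; apply: compact_closed => //; exact: norm_hausdorff.
Qed.

Lemma continuous_evalp (R : realType) (n : nat) (p : mpoly n R) :
  continuous (evalp p).
Proof.
have sumc (I : Type) (s : seq I) (F : I -> 'rV[R]_n -> R) :
    (forall i, continuous (F i)) -> continuous (fun x => \sum_(i <- s) F i x).
  move=> Fc; elim: s => [|i s IH] x.
    by under eq_fun do rewrite big_nil; exact: cst_continuous.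
  under eq_fun do rewrite big_cons.
  by apply: (cvgD (Fc i x)); exact: IH.
have prodc (I : Type) (s : seq I) (F : I -> 'rV[R]_n -> R) :
    (forall i, continuous (F i)) -> continuous (fun x => \prod_(i <- s) F i x).
  move=> Fc; elim: s => [|i s IH] x.
    by under eq_fun do rewrite big_nil; exact: cst_continuous.
  under eq_fun do rewrite big_cons.
  by apply: (cvgM (Fc i x)); exact: IH.
rewrite /evalp; under eq_fun do rewrite mevalE.
apply: sumc => m x.
have mc : continuous (fun y : 'rV[R]_n => \prod_i y ord0 i ^+ m i).
  apply: (prodc _ _ (fun i (y : 'rV[R]_n) => y ord0 i ^+ m i)) => i {}x.
  exact: (continuous_comp (@coord_continuous R 1 n ord0 i x)
    (@exprn_continuous R (m i) (x ord0 i))).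
exact: (cvgM (cvg_cst (mcoeff m p)) (mc x)).
Qed.

Definition Umap (R : realType) (n : nat) (f g : mpoly n R)
    (x : borelRn R n) : borelRn R 2 :=
  \row_(i < 2) if i == ord0 then evalp f x else evalp g x.

Lemma measurable_Umap (R : realType) (n : nat) (f g : mpoly n R) :
  measurable_fun [set: borelRn R n] (Umap f g).
Proof.
have Uc : continuous (Umap f g : 'rV[R]_n -> 'rV[R]_2).
  move=> x A [P Px PA].
  have : \forall y \near x, forall ij : 'I_1 * 'I_2,
      P ij.1 ij.2 ((Umap f g y : 'rV[R]_2) ij.1 ij.2).
    have fx : Filter (nbhs x) := nbhs_filter x.
    apply: (@filter_forall _ _ _ _ fx) => -[i j].
    have UE y : Umap f g y i j = if j == ord0 then evalp f y else evalp g y.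
      by rewrite mxE.
    have := Px i j; rewrite UE.
    case: (j == ord0) UE => UE /(@continuous_evalp R n _ x);
        apply: (@filterS _ _ fx) => y.
      by rewrite /= UE.
    by rewrite /= UE.
  by apply: filterS => y Py; apply: PA => i j; exact: (Py (i, j)).
apply: (@measurability _ _ (borelRn R n) (borelRn R 2) setT _
  (@open 'rV[R]_2)) => // _ [A oA <-].
by rewrite setTI; apply: sub_sigma_algebra; move/continuousP : Uc; exact.
Qed.

Section Upush.
Context (R : realType) (n : nat) (lambda : {measure set (borelRn R n) -> \bar R})
  (K : set 'rV[R]_n) (cK : compact K) (f g : mpoly n R).

(* [mrestr lambda _ A] is [lambda (A `&` K)]: the measure of C is lambda of its
   preimage under the restriction of [Umap f g] to K. *)
Definition Upush : set (borelRn R 2) -> \bar R :=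
  pushforward (mrestr lambda (compact_borel cK)) (Umap f g).

Let mU := measurable_Umap f g.

Let Upush0 : Upush set0 = 0%E.
Proof. exact: measure0. Qed.

Let Upush_ge0 A : (0 <= Upush A)%E.
Proof. exact: measure_ge0. Qed.

Let Upush_sigma_additive : semi_sigma_additive Upush.
Proof. exact: measure_semi_sigma_additive. Qed.

HB.instance Definition _ := isMeasure.Build _ _ _ Upush
  Upush0 Upush_ge0 Upush_sigma_additive.

End Upush.

Definition moment (R : realType) (m : nat)
    (mu : {measure set (borelRn R m) -> \bar R}) (a : multinom m) : R :=
  \int[mu]_z (\prod_(i < m) (z : 'rV[R]_m) ord0 i ^+ a i).

Definition riesz (R : realType) (m : nat) (z : multinom m -> R)
    (p : mpoly m R) : R :=
  \sum_(a <- msupp p) mcoeff a p * z a.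

(* [bmultinom m d.+1] is the finite type of the multi-indices of degree at most
   d; it is enumerated in order to index the rows and columns. *)
Definition locmx (R : realType) (m d : nat) (p : mpoly m R)
    (z : multinom m -> R) : 'M[R]_#|{: bmultinom m d.+1}| :=
  \matrix_(i, j)
    riesz z (p * mpolyX R (mnm_add (bmnm (enum_val i)) (bmnm (enum_val j)))).

Definition psdmx (R : realType) (N : nat) (A : 'M[R]_N) : Prop :=
  A^T = A /\ forall x : 'cV[R]_N, 0 <= (x^T *m A *m x) ord0 ord0.

Definition loewner_ge (R : realType) (N : nat) (A B : 'M[R]_N) : Prop :=
  psdmx (A - B).

(* [msize s] is the degree of s plus one, and 0 for the zero polynomial. *)
Definition sos (R : realType) (m d : nat) : set (mpoly m R) :=
  [set s | (msize s <= (2 * d).+1)%N /\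
    exists qs : seq (mpoly m R), s = \sum_(q <- qs) q ^+ 2].

Definition uX (R : realType) : mpoly 2 R := mpolyX R (mnm1 ord0).
Definition vX (R : realType) : mpoly 2 R := mpolyX R (mnm1 ord_max).

Definition primal_feasible (R : realType) (y : multinom 2 -> R) (d : nat) :
    set R :=
  [set a | loewner_ge (locmx d (uX R) y) (a *: locmx d (vX R) y)].

Definition primal_value (R : realType) (y : multinom 2 -> R) (d : nat) :
    \bar R :=
  ereal_sup [set a%:E | a in primal_feasible y d].

Definition dual_objective (R : realType)
    (mu : {measure set (borelRn R 2) -> \bar R}) (s : mpoly 2 R) : R :=
  \int[mu]_z evalp (uX R * s) z.

Definition dual_feasible (R : realType)
    (mu : {measure set (borelRn R 2) -> \bar R}) (d : nat) : set (mpoly 2 R) :=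
  [set s | sos d s /\ \int[mu]_z evalp (vX R * s) z = 1].

Definition dual_value (R : realType)
    (mu : {measure set (borelRn R 2) -> \bar R}) (d : nat) : \bar R :=
  ereal_inf [set (dual_objective mu s)%:E | s in dual_feasible mu d].

(* Main.v *)
(* For [q] of degree at most [d] with coefficient vector [x], the quadratic forms
   of the matrices M_d(u y) and M_d(v y) at [x] are the integrals of [u q^2] and
   [v q^2] against the pushforward [mu]. Both programs thus compute the smallest
   generalized eigenvalue of this pencil: it is attained because [u] is bounded
   by a multiple of [v] on the support of [mu], so that the kernel of M_d(v y)
   lies in that of M_d(u y), and the square of a minimizing polynomial solves
   the dual program. If [a_d >= r > rho] for all [d], then [(u - r v) q^2] has a
   nonnegative integral for every [q], which fails for polynomials [q] peaking
   at the image of a minimizer of [f / g]. *)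
Require Import Defs.
From HB Require Import structures.
From mathcomp Require Import all_boot all_order all_algebra.
From mathcomp.multinomials Require Import -(notations) mpoly.
From mathcomp Require Import all_classical all_reals all_analysis.
From mathcomp Require Import measurable_realfun ring lra.

Set Implicit Arguments.
Unset Strict Implicit.
Unset Printing Implicit Defensive.

Import Order.TTheory GRing.Theory Num.Theory.
Import numFieldNormedType.Exports.

Local Open Scope classical_set_scope.
Local Open Scope ring_scope.

(** * Quadratic forms and positive semidefinite matrices *)

(** Row vectors replace the columns of [psdmx], so that row spaces and left kernels of matrices
    apply directly. *)
Definition qform (R : realType) (N : nat) (A : 'M[R]_N) (z : 'rV[R]_N) : R :=
  (z *m A *m z^T) ord0 ord0.

Lemma qformE (R : realType) (N : nat) (A : 'M[R]_N) (z : 'rV[R]_N) :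
  qform A z = \sum_j (\sum_i z ord0 i * A i j) * z ord0 j.
Proof. by rewrite /qform mxE; apply: eq_bigr => j _; rewrite !mxE. Qed.

Lemma psdmxE (R : realType) (N : nat) (A : 'M[R]_N) :
  psdmx A <-> A^T = A /\ forall z, 0 <= qform A z.
Proof.
split=> -[As Ap]; split=> // z; first by have := Ap z^T; rewrite trmxK.
by have := Ap z^T; rewrite /qform trmxK.
Qed.

Lemma qformB (R : realType) (N : nat) (A B : 'M[R]_N) z :
  qform (A - B) z = qform A z - qform B z.
Proof. by rewrite /qform mulmxBr mulmxBl !mxE. Qed.

Lemma qformZ (R : realType) (N : nat) (a : R) (A : 'M[R]_N) z :
  qform (a *: A) z = a * qform A z.
Proof. by rewrite /qform -scalemxAr -scalemxAl !mxE. Qed.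

Lemma qform_scale (R : realType) (N : nat) (a : R) (A : 'M[R]_N) z :
  qform A (a *: z) = a ^+ 2 * qform A z.
Proof. by rewrite /qform linearZ /= -!scalemxAl -scalemxAr scalerA !mxE. Qed.

Lemma qformD (R : realType) (N : nat) (A : 'M[R]_N) z w : A^T = A ->
  qform A (z + w) = qform A z + 2 * (z *m A *m w^T) ord0 ord0 + qform A w.
Proof.
move=> As; rewrite /qform linearD /= !mulmxDl !mulmxDr.
have -> : w *m A *m z^T = (z *m A *m w^T)^T by rewrite !trmx_mul trmxK As mulmxA.
by rewrite !mxE; ring.
Qed.

Lemma mulmx_tr_gt0 (R : realType) (N : nat) (z : 'rV[R]_N) :
  z != 0 -> 0 < (z *m z^T) ord0 ord0.
Proof.
move=> z0; rewrite lt_def !mxE.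
have ge0 i : true -> 0 <= z ord0 i * z^T i ord0.
  by rewrite mxE -expr2 sqr_ge0.
rewrite sumr_ge0 // andbT; apply: contra z0 => /eqP /psumr_eq0P z0.
apply/eqP/rowP => i; have /eqP := z0 ge0 i isT.
by rewrite !mxE mulf_eq0 orbb => /eqP.
Qed.

(** If [w = z *m A] were nonzero, the form at [z + t *: w] would be [2 t |w|^2 + t^2 (qform A w)],
    which is negative for a small negative [t]; [t = - e / (q + 1)] is small enough. *)
Lemma psdmx_qform0 (R : realType) (N : nat) (A : 'M[R]_N) z :
  psdmx A -> qform A z = 0 -> z *m A = 0.
Proof.
have neg (e q : R) : 0 <= q -> 0 < e ->
    2 * (- e / (q + 1) * e) + (- e / (q + 1)) ^+ 2 * q < 0.
  move=> q0 e0.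
  have -> : 2 * (- e / (q + 1) * e) + (- e / (q + 1)) ^+ 2 * q =
      - ((e / (q + 1)) ^+ 2 * (q + 2)) by field; lra.
  by rewrite oppr_lt0 mulr_gt0 ?exprn_gt0 ?divr_gt0//; lra.
move=> /psdmxE[As Ap] Az0; apply/eqP; apply: contraT => /mulmx_tr_gt0.
set e := (_ *m _) _ _ => e0; set q := qform A (z *m A).
have := Ap (z + (- e / (q + 1)) *: (z *m A)).
rewrite qformD // qform_scale Az0 linearZ /= -scalemxAr mxE -/e -/q add0r.
by rewrite leNgt neg //; exact: Ap.
Qed.

(** For symmetric [B], a vector [u = w *m B] with [u *m B = 0] satisfies
    [u *m u^T = u *m B *m w^T = 0], so kernel and row space meet trivially; by rank-nullity they
    span everything. *)
Lemma sym_ker_decomp (R : realType) (N : nat) (B : 'M[R]_N) (z : 'rV[R]_N) :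
  B^T = B -> exists k w, z = k + w /\ k *m B = 0 /\ (w <= B)%MS.
Proof.
move=> Bs; have capB : (kermx B :&: B = 0)%MS.
  apply/eqP; rewrite -submx0; apply/rV_subP => u.
  rewrite sub_capmx => /andP[/sub_kermxP uB0 /submxP[w uE]].
  rewrite submx0; apply: contraT => /mulmx_tr_gt0.
  by rewrite {2}uE trmx_mul Bs mulmxA uB0 mul0mx mxE ltxx.
have /sub_addsmxP[[k w] ->] : (z <= kermx B + B)%MS.
  apply: submx_full; rewrite /row_full; apply/eqP.
  have := mxrank_sum_cap (kermx B) B.
  by rewrite capB mxrank0 addn0 mxrank_ker subnK // rank_leq_row.
exists (k *m kermx B), (w *m B); split=> //=; split; last exact: submxMl.
by rewrite -mulmxA mulmx_ker mulmx0.
Qed.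

(** * Attainment of the smallest generalized eigenvalue *)

Lemma continuous_sum (R : realType) (T : topologicalType) (I : Type) (s : seq I)
    (F : I -> T -> R) :
  (forall i, continuous (F i)) -> continuous (fun x => \sum_(i <- s) F i x).
Proof. by move=> Fc; apply: continuous_big => //; exact: add_continuous. Qed.

Lemma continuous_qform (R : realType) (N : nat) (A : 'M[R]_N) :
  continuous (qform A).
Proof.
rewrite (_ : qform A = fun z : 'rV[R]_N =>
    \sum_j (\sum_i z ord0 i * A i j) * z ord0 j); last first.
  by apply/funext => z; rewrite qformE.
have rowc j : continuous (fun z : 'rV[R]_N => \sum_i z ord0 i * A i j).
  apply: continuous_sum => i z.
  exact: (cvgM (@coord_continuous R 1 N ord0 i z) (cvg_cst (A i j))).
apply: continuous_sum => j z.
exact: (cvgM (rowc j z) (@coord_continuous R 1 N ord0 j z)).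
Qed.

Lemma closed_submx (R : realType) (M N : nat) (B : 'M[R]_(M, N)) :
  closed [set z : 'rV[R]_N | (z <= B)%MS].
Proof.
rewrite (_ : [set _ | _] =
    \bigcap_j [set z : 'rV[R]_N | (z *m cokermx B) ord0 j = 0]).
  apply: closed_bigI => j _.
  have jc : continuous (fun z : 'rV[R]_N => (z *m cokermx B) ord0 j).
    under eq_fun do rewrite mxE.
    apply: continuous_sum => i z.
    exact: (cvgM (@coord_continuous R 1 N ord0 i z) (cvg_cst (cokermx B i j))).
  exact: (closed_comp (fun z _ => jc z) (@closed_eq R 0)).
apply/seteqP; split => z /=; rewrite submxE.
  by move=> /eqP zB j _; rewrite /= zB mxE.
by move=> zB; apply/eqP/rowP => j; rewrite [RHS]mxE; exact: zB.
Qed.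

(* [B] is positive definite on its row space, whose unit sphere is compact; the
   complementary kernel of [B] is also in the kernel of [A]. *)
Lemma rayleigh_min_psd (R : realType) (N : nat) (A B : 'M[R]_N) (c : R) :
  psdmx A -> psdmx B -> psdmx (c *: B - A) -> (exists z, 0 < qform B z) ->
  exists a z, [/\ psdmx (A - a *: B), qform B z = 1 & qform A z = a].
Proof.
move=> pA pB pBA [z1 z1B].
have [As Ap] := (psdmxE A).1 pA; have [Bs Bp] := (psdmxE B).1 pB.
pose S := [set z : 'rV[R]_N | (z <= B)%MS /\ `|z| = 1].
have Bgt0 w : (w <= B)%MS -> w != 0 -> 0 < qform B w.
  move=> /submxP[u wE] w0; rewrite lt_def Bp andbT.
  apply: contra w0 => /eqP /(psdmx_qform0 pB) wB.
  apply: contraT => /mulmx_tr_gt0; rewrite {2}wE trmx_mul Bs mulmxA wB.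
  by rewrite mul0mx mxE ltxx.
(* On the kernel of [B], semidefiniteness of [c *: B - A] forces the form of [A] to be nonpositive,
   hence zero. *)
have kerA (k : 'rV[R]_N) : k *m B = 0 -> k *m A = 0.
  move=> kB; apply: (psdmx_qform0 pA); apply/eqP; rewrite eq_le Ap andbT.
  have := ((psdmxE _).1 pBA).2 k.
  by rewrite qformB qformZ {1}/qform kB mul0mx mxE mulr0 add0r oppr_ge0.
(* The component in the kernel of [B] contributes to neither form, cross terms included. *)
have decomp z :
    exists2 w, (w <= B)%MS & qform A z = qform A w /\ qform B z = qform B w.
  have [k [w [-> [kB wB]]]] := sym_ker_decomp z Bs.
  exists w => //; rewrite !qformD// /qform.
  by rewrite (kerA _ kB) kB !mul0mx !mxE mulr0 !add0r.
have normS w : (w <= B)%MS -> w != 0 -> S (`|w|^-1 *: w).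
  move=> wB w0; split; first exact: scalemx_sub.
  by rewrite normrZ normfV normr_id mulVf // normr_eq0.
have S0 z : S z -> z != 0.
  by move=> [_ z1']; rewrite -normr_eq0 z1' oner_eq0.
have Sne : S !=set0.
  have [w wB [_ Bw]] := decomp z1.
  exists (`|w|^-1 *: w); apply: normS => //; apply: contraTneq z1B => w0.
  by rewrite Bw w0 /qform !mul0mx mxE ltxx.
have cS : compact S.
  apply: bounded_closed_compact.
    exists 1; split=> // x x1 z [_ z1'].
    by apply: le_trans (ltW x1); rewrite [leLHS]z1'.
  apply: closedI; first exact: closed_submx.
  exact: (closed_comp (fun z _ => @norm_continuous _ _ z) (@closed_eq R 1)).
have Fc : {within S, continuous (fun z => qform A z / qform B z)}.
  apply: continuous_in_subspaceT => z /set_mem Sz.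
  have Bz0 : qform B z != 0.
    by rewrite gt_eqF //; apply: Bgt0; [case: Sz|exact: S0].
  exact: (cvgM (@continuous_qform _ _ A z)
    (cvgV Bz0 (@continuous_qform _ _ B z))).
have [z0 /set_mem Sz0 minz0] := EVT_min_rV Sne cS Fc.
set a := qform A z0 / qform B z0 in minz0.
have Bz0 : 0 < qform B z0 by apply: Bgt0; [case: Sz0|exact: S0].
(* The quotient is invariant under scaling, so the minimizer may be rescaled until the form of [B]
   equals 1. *)
exists a, ((Num.sqrt (qform B z0))^-1 *: z0); split.
- apply/psdmxE; split; first by rewrite linearB linearZ /= As Bs.
  move=> z; rewrite qformB qformZ; have [w wB [-> ->]] := decomp z.
  have [->|w0] := eqVneq w 0; first by rewrite /qform !mul0mx mxE mulr0 subr0.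
  have := minz0 _ (mem_set (normS _ wB w0)).
  rewrite !qform_scale -mulf_div divff ?mul1r; last first.
    by rewrite expf_neq0 // invr_neq0 // normr_eq0.
  by rewrite ler_pdivlMr ?Bgt0 // subr_ge0.
- by rewrite qform_scale exprVn sqr_sqrtr ?Bp // mulVf // gt_eqF.
- by rewrite qform_scale exprVn sqr_sqrtr ?Bp // mulrC.
Qed.

(** Replacing [A] by [A - r *: B] shifts the eigenvalue by [r] and reduces to the case where [A] is
    positive semidefinite. *)
Lemma rayleigh_min (R : realType) (N : nat) (A B : 'M[R]_N) (r c : R) :
  psdmx B -> psdmx (A - r *: B) -> psdmx (c *: B - A) ->
  (exists z, 0 < qform B z) ->
  exists a z, [/\ psdmx (A - a *: B), qform B z = 1 & qform A z = a].
Proof.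
move=> pB pA pBA Bz.
have pBA' : psdmx ((c - r) *: B - (A - r *: B)).
  by rewrite scalerBl opprB addrA subrK.
have [a [z [paz Bz1 Az]]] := rayleigh_min_psd pA pB pBA' Bz.
exists (r + a), z; split=> //; first by rewrite scalerDl opprD addrA.
move: Az; rewrite qformB qformZ Bz1 mulr1 => /eqP.
by rewrite subr_eq addrC => /eqP.
Qed.

(** * Degrees in sums of squares, and coefficient vectors *)

(** Leading terms of squares cannot cancel: if [M] is the greatest leading monomial of the summands,
    the coefficient of [2M] in the sum is a sum of squares, one of them nonzero. The order is
    graded, so [M] also has the greatest degree. *)
Lemma sos_msize (R : realType) (m d : nat) (qs : seq (mpoly m R)) q :
  (msize (\sum_(p <- qs) p ^+ 2)%R <= (2 * d).+1)%N -> q \in qs ->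
  (msize q <= d.+1)%N.
Proof.
move=> sz qqs; rewrite leqNgt; apply/negP => dq.
have q0 : q != 0 by rewrite -msize_poly_eq0 -lt0n; exact: leq_trans dq.
have iq : (index q qs < size qs)%N by rewrite index_mem.
pose F (i : 'I_(size qs)) := mlead qs`_i.
have [i _ imax] := @arg_maxP _ _ _ (Ordinal iq) xpredT F isT.
set M := F i in imax.
have leM p : p \in qs -> (mlead p <= M)%O.
  by move=> pqs; have := imax (Ordinal (etrans (index_mem p qs) pqs)) isT;
    rewrite /F /= nth_index.
have dM : (d.+1 <= mdeg M)%N.
  by rewrite (leq_trans _ (lemc_mdeg (leM q qqs))) // -ltnS mlead_deg.
(* The zero polynomial has leading monomial 0 by convention; the positive degree of [M] excludes
   it. *)
have M0 : mcoeff M qs`_i != 0.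
  rewrite mleadc_eq0; apply: contraTneq dM => qi0.
  by rewrite /M /F qi0 mlead0 mdeg0.
have : mcoeff (mnm_add M M) (\sum_(p <- qs) p ^+ 2) != 0.
  rewrite raddf_sum /= (eq_big_seq (fun p => mcoeff M p ^+ 2)); last first.
    by move=> p pqs; rewrite expr2 mleadcMW ?leM // -expr2.
  rewrite gt_eqF // (big_nth 0) big_mkord (bigD1 i) //= ltr_pwDl ?exprn_even_gt0 //.
  by rewrite sumr_ge0 // => j _; exact: sqr_ge0.
rewrite -mcoeff_msupp => /msize_mdeg_lt; rewrite mdegD => /leq_trans /(_ sz).
by rewrite ltnS addnn -mul2n leq_mul2l /= leqNgt dM.
Qed.

(** The coefficients follow the enumeration that indexes [locmx]. *)
Definition mpoly_of_row (R : realType) (m d : nat)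
    (z : 'rV[R]_#|{: bmultinom m d.+1}|) : mpoly m R :=
  \sum_i z ord0 i *: mpolyX R (bmnm (enum_val i)).

Lemma msize_mpoly_of_row (R : realType) (m d : nat)
    (z : 'rV[R]_#|{: bmultinom m d.+1}|) :
  (msize (mpoly_of_row z) <= d.+1)%N.
Proof.
apply: leq_trans (msize_sum _ _ _) _; apply/bigmax_leqP => i _.
by apply: leq_trans (msizeZ_le _ _) _; rewrite msizeX bmdeg.
Qed.

Lemma mpoly_of_row_surj (R : realType) (m d : nat) (q : mpoly m R) :
  (msize q <= d.+1)%N -> exists z, mpoly_of_row (d := d) z = q.
Proof.
move=> dq; exists (\row_i mcoeff (bmnm (enum_val i)) q).
rewrite [RHS](mpolywE dq) /mpoly_of_row.
rewrite (big_enum_val (fun a : bmultinom m d.+1 =>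
  mcoeff (bmnm a) q *: mpolyX R (bmnm a))).
by apply: eq_bigr => i _; rewrite mxE.
Qed.

(** * Integrals of polynomials and localizing matrices *)

Section PolynomialIntegral.
Context (R : realType) (m : nat) (mu : {measure set (borelRn R m) -> \bar R}).
Hypothesis mu_int : forall p : mpoly m R,
  mu.-integrable [set: borelRn R m] (EFin \o evalp p).

Definition mpint (p : mpoly m R) : R := \int[mu]_z evalp p z.

Lemma mpintD p q : mpint (p + q) = mpint p + mpint q.
Proof.
rewrite /mpint -RintegralD //; apply: eq_Rintegral => z _.
by rewrite /evalp mevalD.
Qed.

Lemma mpintZ c p : mpint (c *: p) = c * mpint p.
Proof.
rewrite /mpint -RintegralZl //; apply: eq_Rintegral => z _.
by rewrite /evalp mevalZ.
Qed.

Lemma mpintB p q : mpint (p - q) = mpint p - mpint q.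
Proof. by rewrite -scaleN1r mpintD mpintZ mulN1r. Qed.

Lemma mpint_sum (I : Type) (s : seq I) (F : I -> mpoly m R) :
  mpint (\sum_(i <- s) F i) = \sum_(i <- s) mpint (F i).
Proof.
elim: s => [|i s IH]; last by rewrite !big_cons mpintD IH.
by rewrite !big_nil -(scale0r 0) mpintZ mul0r.
Qed.

Lemma riesz_moment p : riesz (moment mu) p = mpint p.
Proof.
rewrite [in RHS](mpolyE p) mpint_sum; apply: eq_bigr => a _.
rewrite mpintZ; congr (_ * _); apply: eq_Rintegral => z _.
by rewrite /evalp mevalX.
Qed.

Lemma locmx_moment_sym d p :
  (locmx d p (moment mu))^T = locmx d p (moment mu).
Proof. by apply/matrixP => i j; rewrite !mxE addmC. Qed.

Lemma qform_locmx_moment d p z :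
  qform (locmx d p (moment mu)) z = mpint (p * mpoly_of_row z ^+ 2).
Proof.
rewrite qformE expr2 mulrA /mpoly_of_row [in RHS]mulr_sumr mpint_sum.
apply: eq_bigr => j _; rewrite -scalerAr mpintZ mulrC; congr (_ * _).
rewrite mulr_sumr mulr_suml mpint_sum; apply: eq_bigr => i _.
by rewrite -scalerAr -scalerAl mpintZ mxE riesz_moment mpolyXD mulrA.
Qed.

End PolynomialIntegral.

(** * Null sets and the support of a Borel measure *)

Lemma open_borel (R : realType) (n : nat) (V : set 'rV[R]_n) :
  open V -> measurable (V : set (borelRn R n)).
Proof. by move=> oV; exact: sub_sigma_algebra. Qed.

Lemma measurable_evalp (R : realType) (n : nat) (p : mpoly n R) :
  measurable_fun [set: borelRn R n] (evalp p).
Proof.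
apply: (measurability _ (RGenOpens.measurableE R)) => //.
move=> _ [_ [x [y ->]] <-]; rewrite setTI; apply: open_borel.
have /continuousP pc := @continuous_evalp R n p.
by apply: pc; exact: interval_open.
Qed.

(** Compactness is used in its near-covering form: each point of [F] has a neighborhood inside a
    null open set, and one negligible set then has to contain all of [F]. *)
Lemma compact_negligible (R : realType) (n : nat)
    (mu : {measure set (borelRn R n) -> \bar R}) (F : set 'rV[R]_n) :
  compact F ->
  (forall x, F x -> exists V : set 'rV[R]_n, [/\ open V, V x & mu V = 0%E]) ->
  mu.-negligible (F : set (borelRn R n)).
Proof.
move=> /compact_near_coveringP cF Fnull.
(* [G] collects the properties that hold for all large enough negligible sets, ordered by
   inclusion. *)
pose G : set_system (set (borelRn R n)) :=
  [set Q | exists2 N0, mu.-negligible N0 &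
    forall N, mu.-negligible N -> N0 `<=` N -> Q N].
have GF : Filter G.
  split.
  - by exists set0 => //; exact: negligible_set0.
  - move=> P Q [N1 n1 PN] [N2 n2 QN]; exists (N1 `|` N2).
      exact: negligibleU.
    by move=> N nN; rewrite subUset => -[? ?]; split; [exact: PN|exact: QN].
  - by move=> P Q PQ [N1 n1 PN]; exists N1 => // N nN N1N; apply/PQ/PN.
have nearF x : F x -> \forall y \near x & N \near G, N y.
  move=> /Fnull[V [oV Vx V0]]; exists (V, [set N | V `<=` N]) => /=.
    split; first exact: open_nbhs_nbhs.
    by exists V => //; apply/negligibleP => //; exact: open_borel.
  by move=> [y N] [/= Vy VN]; exact: VN.
have [N nN FN] := cF _ G (fun N x => N x) GF nearF.
by apply: negligibleS (nN); exact: (FN N nN (@subset_refl _ N)).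
Qed.

(* The complement of the support is a countable union of compact sets covered
   by null open sets: the points of norm at most [k] at distance at least
   [1 / (k + 1)] from the support. *)
Lemma msupport_setC_null (R : realType) (n : nat)
    (mu : {measure set (borelRn R n) -> \bar R}) :
  mu.-negligible (~` msupport mu : set (borelRn R n)).
Proof.
pose S := msupport mu.
have nullS x : ~ S x -> exists V : set 'rV[R]_n, [/\ open V, V x & mu V = 0%E].
  move=> /existsNP[V] /not_implyP[oV] /not_implyP[Vx /negP].
  rewrite -leNgt => V0; exists V; split=> //.
  by apply/eqP; rewrite eq_le V0 measure_ge0.
have oS : open (~` S).
  rewrite openE => x /nullS[V [oV Vx V0]].
  apply: (filterS _ (open_nbhs_nbhs (conj oV Vx))) => y Vy Sy.
  by have := Sy V oV Vy; rewrite V0 ltxx.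
pose F k := [set x : 'rV[R]_n | `|x| <= k%:R] `&`
  ~` \bigcup_(y in S) ball y k.+1%:R^-1.
have FS k x : F k x -> ~ S x.
  by move=> [_ Fx] Sx; apply: Fx; exists x => //; exact: ballxx.
apply: (@negligibleS _ _ _ _ (\bigcup_k (F k : set (borelRn R n)))); last first.
  apply: negligible_bigcup => k; apply: compact_negligible.
    apply: bounded_closed_compact.
      by exists k%:R; split=> // x kx z [zk _]; apply: le_trans zk (ltW kx).
    apply: closedI; last first.
      by apply: open_closedC; apply: bigcup_open => y _; exact: ball_open.
    exact: (closed_comp (fun z _ => @norm_continuous _ _ z) (@closed_le R k%:R)).
  by move=> x /FS; exact: nullS.
move=> x Sx; have /nbhs_ballP[e e0 eS] := open_nbhs_nbhs (conj oS Sx).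
(* This [k] is at least [|x|], and [1 / (k + 1)] is at most [e], the radius of a ball around [x]
   that avoids the support. *)
pose k := (Num.trunc `|x| + Num.trunc e^-1).+1.
exists k => //; split => /=.
  rewrite ltW // (lt_le_trans (truncnS_gt _)) // ler_nat /k ltnS.
  exact: leq_addr.
move=> [y Sy xy]; apply: (eS y) => //=.
apply: ball_sym; apply: le_ball xy.
rewrite -[leRHS]invrK lef_pV2 ?posrE ?invr_gt0 //.
rewrite ltW // (lt_le_trans (truncnS_gt _)) // ler_nat /k ltnS.
by rewrite (leq_trans (leq_addl (Num.trunc `|x|) _)).
Qed.

(** * Polynomials against a finite measure carried by a compact set *)

Lemma compact_evalp_bounded (R : realType) (n : nat) (K : set 'rV[R]_n)
    (p : mpoly n R) :
  compact K -> exists M, 0 <= M /\ forall x, K x -> `|evalp p x| <= M.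
Proof.
move=> cK; have pc : {within K, continuous (evalp p)}.
  by apply: continuous_subspaceT; exact: continuous_evalp.
have /compact_bounded[M [_ /(_ (`|M| + 1))]] := continuous_compact pc cK.
rewrite (le_lt_trans (ler_norm M)) ?ltrDl // => /(_ isT) KM.
by exists (`|M| + 1); split=> [|x Kx]; [rewrite addr_ge0|apply: KM; exists x].
Qed.

Definition sqdist (R : realType) (m : nat) (z0 : 'rV[R]_m) : mpoly m R :=
  \sum_i (mpolyX R (mnm1 i) - mpolyC m (z0 ord0 i)) ^+ 2.

Lemma evalp_sqdist (R : realType) (m : nat) (z0 z : 'rV[R]_m) :
  evalp (sqdist z0) z = \sum_i (z ord0 i - z0 ord0 i) ^+ 2.
Proof.
rewrite /evalp raddf_sum; apply: eq_bigr => i _.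
by rewrite /= expr2 mevalM !mevalB mevalXU mevalC -expr2.
Qed.

(** Balls are those of the maximum norm, and each squared coordinate difference is at most the
    Euclidean sum. *)
Lemma sqdist_ball (R : realType) (m : nat) (z0 z : 'rV[R]_m) (e : R) : 0 < e ->
  evalp (sqdist z0) z < e ^+ 2 -> ball z0 e z.
Proof.
move=> e0; rewrite evalp_sqdist => ze; split=> // i j; rewrite ord1 /ball /=.
rewrite distrC -(ltr_pXn2r (n := 2)) ?nnegrE ?(ltW e0) // real_normK ?num_real //.
apply: le_lt_trans ze; rewrite (bigD1 j) //= lerDl.
by rewrite sumr_ge0 // => k _; exact: sqr_ge0.
Qed.

Section CompactlyCarried.
Context (R : realType) (m : nat) (mu : {measure set (borelRn R m) -> \bar R}).
Context (T : set 'rV[R]_m).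
Hypotheses (mu_fin : (mu setT < +oo)%E) (cT : compact T)
  (muTC : mu (~` T) = 0%E).

Let mT : measurable (T : set (borelRn R m)). Proof. exact: compact_borel. Qed.

Lemma evalp_integrable p : mu.-integrable [set: borelRn R m] (EFin \o evalp p).
Proof.
apply/(negligible_integrable (measurableC mT) measurableT _ muTC).
  by apply/measurable_EFinP; exact: measurable_evalp.
rewrite setTD setCK; apply: measurable_bounded_integrable => //.
- by apply: le_lt_trans mu_fin; rewrite le_measure ?inE.
- by apply: measurable_funS (measurable_evalp p).
- have [M [M0 TM]] := compact_evalp_bounded p cT.
  exists M; split=> [|x Mx z Tz]; first exact: ger0_real.
  exact: le_trans (TM z Tz) (ltW Mx).
Qed.

Lemma evalp_integrable_sub (A : set (borelRn R m)) p :
  measurable A -> mu.-integrable A (EFin \o evalp p).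
Proof. by move=> mA; exact: integrableS (evalp_integrable p). Qed.

Lemma mpint_restrict p : mpint mu p = \int[mu]_(z in T) evalp p z.
Proof.
rewrite /mpint /Rintegral.
rewrite (negligible_integral (measurableC mT) measurableT _ muTC); last first.
  exact: evalp_integrable.
by rewrite setTD setCK.
Qed.

Lemma mpint_ge0 p : (forall z, T z -> 0 <= evalp p z) -> 0 <= mpint mu p.
Proof. by move=> p0; rewrite mpint_restrict Rintegral_ge0. Qed.

Lemma le_mpint p q : (forall z, T z -> evalp p z <= evalp q z) ->
  mpint mu p <= mpint mu q.
Proof.
move=> pq; rewrite -subr_ge0 -mpintB; last exact: evalp_integrable.
by apply: mpint_ge0 => z Tz; rewrite /evalp mevalB subr_ge0; exact: pq.
Qed.

(** On the compact set [T] the polynomial is bounded below by its positive minimum, whose integral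
    is positive. *)
Lemma mpint_gt0 p : T !=set0 -> (0 < mu setT)%E ->
  (forall z, T z -> 0 < evalp p z) -> 0 < mpint mu p.
Proof.
move=> T0 mu0 p0; have pc : {within T, continuous (evalp p)}.
  by apply: continuous_subspaceT; exact: continuous_evalp.
have [z0 /set_mem Tz0 minz0] := EVT_min_rV T0 cT pc.
apply: (@lt_le_trans _ _ (mpint mu (mpolyC m (evalp p z0)))).
  rewrite /mpint (_ : evalp _ = cst (evalp p z0)).
    by rewrite Rintegral_cst // mulr_gt0 ?p0 // fine_gt0 // mu0.
  by apply/funext => z; rewrite /evalp mevalC.
by apply: le_mpint => z Tz; rewrite {1}/evalp mevalC; exact/minz0/mem_set.
Qed.

Lemma le_Rintegral_cst (A : set (borelRn R m)) p c : measurable A ->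
  (forall z, A z -> evalp p z <= c) ->
  \int[mu]_(z in A) evalp p z <= c * fine (mu A).
Proof.
move=> mA pc; rewrite -Rintegral_cst //; apply: le_Rintegral => //.
  exact: evalp_integrable_sub.
have := evalp_integrable_sub (mpolyC m c) mA.
apply: eq_integrable => // z _.
by rewrite /= /evalp mevalC.
Qed.

(* [q] is a large power of [1 - |z - z0|^2 / C], where [C] bounds [|z - z0|^2]
   on [T], so that [q^2] concentrates around [z0]. *)
Lemma mpint_mul_sqr_lt0 p (z0 : 'rV[R]_m) :
  T z0 -> (forall V : set 'rV[R]_m, open V -> V z0 -> (0 < mu V)%E) ->
  evalp p z0 < 0 -> exists q, mpint mu (p * q ^+ 2) < 0.
Proof.
move=> Tz0 suppz0 pz0.
pose eta := - evalp p z0 / 2.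
have eta0 : 0 < eta by rewrite divr_gt0 // oppr_gt0.
have [e e0 pe] : exists2 e, 0 < e & forall z, ball z0 e z -> evalp p z <= - eta.
  have : \forall z \near z0, evalp p z <= - eta.
    have : evalp p z0 < - eta by rewrite /eta; lra.
    move=> pz0'; apply: (cvgr_le _ (@continuous_evalp R m p z0)) => //.
  by move/nbhs_ballP => [e e0 pe]; exists e.
have [S [S0 TS]] := compact_evalp_bounded (sqdist z0) cT.
have [M [M0 TM]] := compact_evalp_bounded p cT.
have s0 z : 0 <= evalp (sqdist z0) z.
  by rewrite evalp_sqdist sumr_ge0 // => i _; exact: sqr_ge0.
(* Adding [e ^+ 2] to the bound [S] keeps [C] positive and makes [w] below nonnegative on [T], with
   [e ^+ 2 / C <= 1]. *)
pose C := S + e ^+ 2; have ee0 : 0 < e ^+ 2 by exact: exprn_gt0.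
have C0 : 0 < C by rewrite /C; lra.
pose w : mpoly m R := 1 - C^-1 *: sqdist z0.
have wE z : evalp w z = 1 - evalp (sqdist z0) z / C.
  by rewrite /evalp mevalB meval1 mevalZ mulrC.
(* [w] is at least [a] where the squared distance is below [e ^+ 2 / 2], and at most [b < a] where
   it is at least [e ^+ 2]. *)
pose a := 1 - e ^+ 2 / 2 / C; pose b := 1 - e ^+ 2 / C.
have eC : e ^+ 2 / C <= 1 by rewrite ler_pdivrMr // mul1r /C; lra.
have eC0 : 0 < e ^+ 2 / C by rewrite divr_gt0.
have b0 : 0 <= b by rewrite /b; lra.
have ba : b < a by rewrite /a /b mulrAC; lra.
have a0 : 0 < a by exact: le_lt_trans ba.
pose V := [set z | evalp (sqdist z0) z < e ^+ 2 / 2].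
have oV : open V.
  by apply: (@open_comp _ _ (evalp (sqdist z0)) [set t | t < e ^+ 2 / 2]);
    [move=> z _; exact: continuous_evalp|exact: open_lt].
have mV : measurable (V : set (borelRn R m)) by exact: open_borel.
have V0 : (0 < mu V)%E.
  apply: suppz0 => //; rewrite /V /= evalp_sqdist big1 ?divr_gt0 // => i _.
  by rewrite subrr expr0n.
(* [V] may leave [T], but only through a null set. *)
have VT : mu (T `&` V) = mu V.
  have mTCV : measurable (~` T `&` V : set (borelRn R m)).
    by apply: measurableI => //; exact: measurableC.
  rewrite -[in RHS](setTI V) -(setUv T) setIUl measureU0 //.
  - by apply: measurableI.
  - apply: subset_measure0 muTC => //; exact: measurableC.
have Vfin : mu V \is a fin_num.
  rewrite ge0_fin_numE //; apply: le_lt_trans mu_fin.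
  by rewrite le_measure ?inE.
set x := (b / a) ^+ 2.
have x1 : `|x| < 1.
  rewrite ger0_norm ?sqr_ge0 // /x exprn_ilt1 // ?divr_ge0 // ?ltW //.
  by rewrite ltr_pdivrMr // mul1r.
have [k xk] : exists k, x ^+ k * (M * fine (mu setT)) < eta * fine (mu V).
  have fV : 0 < fine (mu V) by rewrite fine_gt0 // V0 /= ltey_eq Vfin.
  have fT : 0 <= M * fine (mu setT) by rewrite mulr_ge0 // fine_ge0.
  (* The added 1 keeps the denominator positive when [M] is 0. *)
  have d0 : 0 < eta * fine (mu V) / (M * fine (mu setT) + 1).
    by rewrite divr_gt0 ?mulr_gt0 //; lra.
  have [k _ xk0] := cvgr0_norm_lt _ (cvg_expr x1) _ d0.
  have : x ^+ k < eta * fine (mu V) / (M * fine (mu setT) + 1).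
    by apply: le_lt_trans (ler_norm _) _; exact: (xk0 k (leqnn k)).
  rewrite ltr_pdivlMr; last by lra.
  move=> xk; exists k; apply: le_lt_trans xk.
  by apply: ler_wpM2l; [exact/exprn_ge0/sqr_ge0|lra].
exists (w ^+ k).
have pqE z : evalp (p * (w ^+ k) ^+ 2) z = evalp p z * (evalp w z ^+ 2) ^+ k.
  by rewrite /evalp mevalM !rmorphXn -!exprM mulnC.
rewrite mpint_restrict.
rewrite (_ : T = (T `&` V) `|` (T `&` ~` V)); last first.
  by rewrite -setIUr setUv setIT.
have mTV : measurable (T `&` V : set (borelRn R m)) by exact: measurableI.
have mTVC : measurable (T `&` ~` V : set (borelRn R m)).
  by apply: measurableI => //; exact: measurableC.
rewrite Rintegral_setU //; last 2 first.
  by apply: evalp_integrable_sub; exact: measurableU.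
  by apply/disj_setPS => z [[_ +] [_]].
have Sz z : T z -> evalp (sqdist z0) z <= S.
  by move=> Tz; apply: le_trans (TS z Tz); exact: ler_norm.
have le1 : \int[mu]_(z in T `&` V) evalp (p * (w ^+ k) ^+ 2) z <=
    - eta * (a ^+ 2) ^+ k * fine (mu V).
  rewrite -VT; apply: le_Rintegral_cst => // z [Tz Vz]; rewrite pqE.
  have Bz : ball z0 e z by apply: sqdist_ball => //; apply: lt_trans Vz _; lra.
  apply: (@le_trans _ _ (- eta * (evalp w z ^+ 2) ^+ k)).
    by apply: ler_wpM2r; [exact/exprn_ge0/sqr_ge0|exact: pe].
  rewrite ler_nM2l ?oppr_lt0 // lerXn2r ?nnegrE ?sqr_ge0 //.
  have aw : a <= evalp w z.
    by rewrite wE /a lerD2l lerN2 ler_pM2r ?invr_gt0 // ltW.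
  by rewrite lerXn2r ?nnegrE ?(ltW a0) // (le_trans (ltW a0)).
have le2 : \int[mu]_(z in T `&` ~` V) evalp (p * (w ^+ k) ^+ 2) z <=
    M * (b ^+ 2) ^+ k * fine (mu setT).
  apply: (@le_trans _ _ (M * (b ^+ 2) ^+ k * fine (mu (T `&` ~` V)))).
    apply: le_Rintegral_cst => // z [Tz _]; rewrite pqE.
    (* In the shell between [V] and squared distance [e ^+ 2], [p] is still negative, so the
       integrand is at most 0; farther away, [w] lies between 0 and [b]. *)
    have [se|es] := ltP (evalp (sqdist z0) z) (e ^+ 2).
      apply: (@le_trans _ _ 0); last by rewrite mulr_ge0 ?exprn_ge0.
      apply: mulr_le0_ge0; last exact/exprn_ge0/sqr_ge0.
      by apply: le_trans (pe _ (sqdist_ball e0 se)) _; rewrite oppr_le0 ltW.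
    have w0 : 0 <= evalp w z.
      rewrite wE subr_ge0 ler_pdivrMr // mul1r (le_trans (Sz z Tz)) // /C; lra.
    have wb : evalp w z <= b by rewrite wE /b lerD2l lerN2 ler_pM2r ?invr_gt0.
    apply: (@le_trans _ _ (M * (evalp w z ^+ 2) ^+ k)).
      apply: ler_wpM2r; first exact/exprn_ge0/sqr_ge0.
      by apply: le_trans (TM z Tz); exact: ler_norm.
    by apply: ler_wpM2l => //; rewrite !lerXn2r ?nnegrE ?exprn_ge0.
  apply: ler_wpM2l; first by rewrite mulr_ge0 ?exprn_ge0.
  apply: fine_le.
  - by rewrite ge0_fin_numE //; apply: le_lt_trans mu_fin; rewrite le_measure ?inE.
  - by rewrite ge0_fin_numE.
  - by rewrite le_measure ?inE.
apply: le_lt_trans (lerD le1 le2) _.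
have ak0 : 0 < (a ^+ 2) ^+ k by rewrite !exprn_gt0.
(* Factoring out [(a ^+ 2) ^+ k] leaves exactly the inequality by which [k] was chosen. *)
have -> : (b ^+ 2) ^+ k = x ^+ k * (a ^+ 2) ^+ k.
  by rewrite /x -!exprMn divfK // gt_eqF.
have := xk; rewrite -(ltr_pM2r ak0); lra.
Qed.

End CompactlyCarried.

(** * Primal feasibility and weak duality *)

(** The integral is the quadratic form of the matrix difference at the coefficient vector of [q],
    and these vectors exhaust the row space. *)
Lemma primal_feasibleP (R : realType)
    (mu : {measure set (borelRn R 2) -> \bar R})
    (d : nat) (a : R) :
  (forall p, mu.-integrable [set: borelRn R 2] (EFin \o evalp p)) ->
  primal_feasible (moment mu) d a <->
  forall q, (msize q <= d.+1)%N -> 0 <= mpint mu ((uX R - a *: vX R) * q ^+ 2).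
Proof.
move=> mu_int; have qE z : qform (locmx d (uX R) (moment mu) -
    a *: locmx d (vX R) (moment mu)) z =
    mpint mu ((uX R - a *: vX R) * mpoly_of_row z ^+ 2).
  rewrite qformB qformZ !qform_locmx_moment // mulrBl -scalerAl.
  by rewrite mpintB // mpintZ.
split=> [/psdmxE[_ psd] q /mpoly_of_row_surj[z <-]|psd]; first by rewrite -qE.
apply/psdmxE; split=> [|z]; first by rewrite linearB linearZ /= !locmx_moment_sym.
by rewrite qE; apply: psd; exact: msize_mpoly_of_row.
Qed.

(** By [sos_msize] each square in [s] comes from a polynomial of degree at most [d], to which the
    primal constraint applies; summing gives a nonnegative integral of [(u - a v) s], where [v s]
    integrates to 1. *)
Lemma weak_duality (R : realType) (mu : {measure set (borelRn R 2) -> \bar R})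
    (d : nat) (a : R) (s : mpoly 2 R) :
  (forall p, mu.-integrable [set: borelRn R 2] (EFin \o evalp p)) ->
  primal_feasible (moment mu) d a -> dual_feasible mu d s ->
  a <= dual_objective mu s.
Proof.
move=> mu_int /primal_feasibleP -/(_ mu_int) pa [[sd [qs sE]] vs1].
have : 0 <= mpint mu ((uX R - a *: vX R) * s).
  rewrite sE mulr_sumr mpint_sum // big_seq sumr_ge0 // => q qqs.
  by apply: pa; apply: (sos_msize _ qqs); rewrite -sE.
rewrite mulrBl -scalerAl mpintB // mpintZ //.
by rewrite /mpint vs1 mulr1 subr_ge0.
Qed.

(** * The pushforward measure and its image set *)

Lemma continuous_Umap (R : realType) (n : nat) (f g : mpoly n R) :
  continuous (Umap f g : 'rV[R]_n -> 'rV[R]_2).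
Proof.
move=> x A /nbhs_ballP[e e0 eA].
have fx : Filter (nbhs x) := nbhs_filter x.
have near_ball p : \forall y \near x, ball (evalp p x) e (evalp p y).
  by apply: (@continuous_evalp R n p x); exact: nbhsx_ballx.
apply: (@filterS2 _ _ fx _ _ _ _ (near_ball f) (near_ball g)) => y fy gy.
by apply: eA; split=> // i j; rewrite !mxE; case: ifP.
Qed.

Lemma evalp_uX_Umap (R : realType) (n : nat) (f g : mpoly n R) x :
  evalp (uX R) (Umap f g x) = evalp f x.
Proof. by rewrite /evalp mevalXU mxE. Qed.

Lemma evalp_vX_Umap (R : realType) (n : nat) (f g : mpoly n R) x :
  evalp (vX R) (Umap f g x) = evalp g x.
Proof. by rewrite /evalp mevalXU mxE. Qed.

Section Pushforward.
Context (R : realType) (n : nat) (K : set 'rV[R]_n).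
Context (lambda : {finite_measure set (borelRn R n) -> \bar R}).
Context (f g : mpoly n R) (cK : compact K).
Let mu : {measure set (borelRn R 2) -> \bar R} := Upush lambda cK f g.
Let T : set 'rV[R]_2 := Umap f g @` K.

Lemma compact_Umap : compact T.
Proof.
apply: continuous_compact => //; apply: continuous_subspaceT.
exact: continuous_Umap.
Qed.

Lemma Upush_finite : (mu setT < +oo)%E.
Proof.
rewrite /mu /= /Upush /pushforward preimage_setT /mrestr setTI.
by rewrite ltey_eq fin_num_measure //; exact: compact_borel.
Qed.

Lemma Upush_setC_Umap : mu (~` T) = 0%E.
Proof.
rewrite /mu /= /Upush /pushforward /mrestr.
rewrite (_ : _ `&` _ = set0) ?measure0 //.
by apply/seteqP; split=> // x [/= Tx Kx]; apply: Tx; exists x.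
Qed.

(** The preimage of [V] is an open neighborhood of a support point, hence has positive measure;
    restricting to [K] loses nothing, since the complement of the support is null. *)
Lemma Upush_open_gt0 (V : set 'rV[R]_2) x :
  msupport lambda = K -> K x -> open V -> V (Umap f g x) -> (0 < mu V)%E.
Proof.
move=> suppK Kx oV Vx.
have oUV : open (Umap f g @^-1` V : set 'rV[R]_n).
  by have /continuousP := @continuous_Umap R n f g; exact.
have mK := compact_borel cK; have mUV := open_borel oUV.
rewrite /mu /= /Upush /pushforward /mrestr.
have : (0 < lambda (Umap f g @^-1` V))%E by move: Kx; rewrite -suppK; exact.
rewrite -[X in lambda X]setIT -(setUv K) setIUr measureU0 //.
- exact: measurableI.
- by apply: measurableI => //; exact: measurableC.
apply: measure_negligible; first by apply: measurableI => //; exact: measurableC.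
by apply: negligibleS (msupport_setC_null lambda); rewrite suppK; exact: subIsetr.
Qed.

End Pushforward.

(** * Strong duality and convergence of the values *)

Section Duality.
Context (R : realType) (mu : {measure set (borelRn R 2) -> \bar R}).
Context (T : set 'rV[R]_2) (rho : R).
Hypotheses (mu_fin : (mu setT < +oo)%E) (cT : compact T)
  (muTC : mu (~` T) = 0%E).
Hypotheses (mu_gt0 : (0 < mu setT)%E) (T0 : T !=set0).
Hypothesis v_gt0 : forall z, T z -> 0 < evalp (vX R) z.
Hypothesis rho_le : forall z, T z -> rho * evalp (vX R) z <= evalp (uX R) z.

Let mu_int := evalp_integrable mu_fin cT muTC.

Lemma mpint_v_sqr_ge0 q : 0 <= mpint mu (vX R * q ^+ 2).
Proof.
apply: (mpint_ge0 mu_fin cT muTC) => z Tz.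
by rewrite /evalp mevalM rmorphXn mulr_ge0 ?sqr_ge0 // ltW // v_gt0.
Qed.

Lemma primal_feasible_le d a b :
  b <= a -> primal_feasible (moment mu) d a -> primal_feasible (moment mu) d b.
Proof.
move=> ba /(primal_feasibleP _ _ mu_int) pa; apply/(primal_feasibleP _ _ mu_int).
move=> q /pa; have := mpint_v_sqr_ge0 q.
rewrite !mulrBl -!scalerAl !mpintB // !mpintZ //.
by move=> v0; rewrite !subr_ge0 => /(le_trans _); apply; exact: ler_wpM2r.
Qed.

Lemma rho_primal_feasible d : primal_feasible (moment mu) d rho.
Proof.
apply/(primal_feasibleP _ _ mu_int) => q _; apply: (mpint_ge0 mu_fin cT muTC) => z Tz.
rewrite /evalp mevalM rmorphXn mulr_ge0 ?sqr_ge0 // mevalB mevalZ subr_ge0.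
exact: rho_le.
Qed.

(** A bound of [|u|] divided by the minimum of [v] on [T] serves as [c], the upper constant that
    [rayleigh_min] requires. *)
Lemma evalp_u_le_mul_v :
  exists c, forall z, T z -> evalp (uX R) z <= c * evalp (vX R) z.
Proof.
have [M [M0 TM]] := compact_evalp_bounded (uX R) cT.
have vc : {within T, continuous (evalp (vX R))}.
  by apply: continuous_subspaceT; exact: continuous_evalp.
have [z0 /set_mem Tz0 minz0] := EVT_min_rV T0 cT vc.
exists (M / evalp (vX R) z0) => z Tz.
apply: (le_trans (ler_norm _)); apply: (le_trans (TM z Tz)).
rewrite mulrAC ler_pdivlMr ?v_gt0 // ler_wpM2l //.
exact/minz0/mem_set.
Qed.

(** [a] is the smallest generalized eigenvalue of the pencil and [s] the square of the polynomial of
    an eigenvector: the normalization by [B] is the dual constraint, the value of [A] the dual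
    objective. *)
Lemma strong_duality d : exists a s, [/\ primal_feasible (moment mu) d a,
  dual_feasible mu d s & dual_objective mu s = a].
Proof.
have [c uc] := evalp_u_le_mul_v.
set A := locmx d (uX R) (moment mu); set B := locmx d (vX R) (moment mu).
have psdB : psdmx B.
  apply/psdmxE; split=> [|z]; first exact: locmx_moment_sym.
  by rewrite qform_locmx_moment //; exact: mpint_v_sqr_ge0.
have psdBA : psdmx (c *: B - A).
  apply/psdmxE; split=> [|z]; first by rewrite linearB linearZ /= !locmx_moment_sym.
  rewrite qformB qformZ !qform_locmx_moment // -mpintZ // -mpintB //.
  rewrite scalerAl -mulrBl; apply: (mpint_ge0 mu_fin cT muTC) => w Tw.
  rewrite /evalp mevalM rmorphXn mulr_ge0 ?sqr_ge0 // mevalB mevalZ subr_ge0.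
  exact: uc.
(* The constant polynomial 1 works: the integral of [v] is positive. *)
have B0 : exists z, 0 < qform B z.
  have [|z z1] := @mpoly_of_row_surj R 2 d 1; first by rewrite msize1.
  exists z; rewrite qform_locmx_moment // z1 expr1n mulr1.
  exact: (mpint_gt0 mu_fin cT muTC).
have [a [z [psda Bz Az]]] := rayleigh_min psdB (rho_primal_feasible d) psdBA B0.
exists a, (mpoly_of_row z ^+ 2); split=> //; last first.
  by rewrite -Az qform_locmx_moment.
split; last by rewrite -Bz qform_locmx_moment.
split; last by exists [:: mpoly_of_row z]; rewrite big_seq1.
(* The size formula for products needs nonzero factors, so the zero polynomial is treated apart. *)
have [->|q0] := eqVneq (mpoly_of_row z) 0; first by rewrite expr0n msize0.
have := msize_mpoly_of_row z; rewrite expr2 msizeM // => qd.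
by rewrite -ltnS prednK ?addn_gt0 ?lt0n ?msize_poly_eq0 ?q0 // mul2n -addnn
  (leq_trans (leq_add qd qd)) // addSn addnS.
Qed.

(** Feasible points of equal value are optimal on both sides by weak duality. *)
Lemma primal_dual_value d : exists a s, [/\ primal_feasible (moment mu) d a,
  primal_value (moment mu) d = a%:E, dual_value mu d = a%:E,
  dual_feasible mu d s & dual_objective mu s = a].
Proof.
have [a [s [pa ds sa]]] := strong_duality d; exists a, s; split=> //.
  apply/eqP; rewrite eq_le; apply/andP; split; last first.
    by apply: ereal_sup_ubound; exists a.
  apply: ge_ereal_sup => _ [b pb <-]; rewrite lee_fin -sa.
  exact: (weak_duality mu_int pb ds).
apply/eqP; rewrite eq_le; apply/andP; split.
  by apply: ereal_inf_lbound; exists s => //; rewrite sa.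
apply: le_ereal_inf_tmp => _ [t dt <-]; rewrite lee_fin.
exact: (weak_duality mu_int pa dt).
Qed.

Lemma nonincreasing_primal_value : nonincreasing_seq (primal_value (moment mu)).
Proof.
move=> d e de; apply: le_ereal_sup => _ [a pa <-]; exists a => //.
move: pa => /(primal_feasibleP _ _ mu_int) pa; apply/(primal_feasibleP _ _ mu_int).
by move=> q qd; apply: pa; rewrite (leq_trans qd).
Qed.

Lemma cvg_primal_value z0 : T z0 -> evalp (uX R) z0 = rho * evalp (vX R) z0 ->
  (forall V : set 'rV[R]_2, open V -> V z0 -> (0 < mu V)%E) ->
  primal_value (moment mu) d @[d --> \oo] --> rho%:E.
Proof.
move=> Tz0 uz0 suppz0.
have := ereal_nonincreasing_cvgn nonincreasing_primal_value.
set l := ereal_inf _; suff -> : l = rho%:E by [].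
have le_l d : (l <= primal_value (moment mu) d)%E.
  by apply: ereal_inf_lbound; exists d.
have rho_l : (rho%:E <= l)%E.
  apply: le_ereal_inf_tmp => _ [d _ <-]; apply: ereal_sup_ubound.
  by exists rho => //; exact: rho_primal_feasible.
(* The limit is finite: it lies between [rho] and the value at [d = 0]. *)
have [r lr] : exists r, l = r%:E.
  have [a [_ [_ av _ _ _]]] := primal_dual_value 0.
  exists (fine l); rewrite fineK // fin_numE; apply/andP; split.
    by rewrite gt_eqF // (lt_le_trans _ rho_l) // ltNyr.
  by rewrite lt_eqF // (le_lt_trans (le_l 0%N)) // av ltry.
apply/eqP; rewrite eq_le rho_l andbT lr lee_fin leNgt; apply/negP => rho_r.
(* At [z0], [u - r v = (rho - r) v] is negative if [r > rho], so some square makes the integral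
   negative. *)
have [|q] := @mpint_mul_sqr_lt0 _ _ _ _ mu_fin cT muTC (uX R - r *: vX R) z0
  Tz0 suppz0.
  rewrite /evalp mevalB mevalZ [meval _ (uX R)]uz0 -mulrBl.
  by rewrite nmulr_rlt0 ?subr_lt0 // v_gt0.
rewrite ltNge => /negP; apply.
(* At level [msize q], which exceeds the degree of [q], the polynomial [q] is admissible and
   contradicts feasibility of [r]. *)
have [a [_ [pa av _ _ _]]] := primal_dual_value (msize q).
have ra : r <= a by rewrite -lee_fin -lr -av.
by have /(primal_feasibleP _ _ mu_int) := primal_feasible_le ra pa; apply.
Qed.

End Duality.

Theorem theorem4 (R : realType) (n : nat) (K : set 'rV[R]_n)
    (lambda : {finite_measure set (borelRn R n) -> \bar R})
    (f g : mpoly n R) (K0 : K !=set0) (cK : compact K)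
    (suppK : msupport lambda = K)
    (g_gt0 : forall x, K x -> 0 < evalp g x) :
  let rho := inf [set evalp f x / evalp g x | x in K] in
  let mu : {measure set (borelRn R 2) -> \bar R} := Upush lambda cK f g in
  let y := moment mu in
  let a_ := primal_value y in
  let rho_ := dual_value mu in
  [/\ exists2 x, K x & evalp f x / evalp g x = rho,
      forall d, exists a : R,
        [/\ primal_feasible y d a, a%:E = a_ d & rho <= a],
      forall d, rho_ d = a_ d /\
        exists s, dual_feasible mu d s /\ (dual_objective mu s)%:E = rho_ d
    & nonincreasing_seq a_ /\ a_ d @[d --> \oo] --> rho%:E].
Proof.
move=> rho mu y a_ rho_.
have quotc : {within K, continuous (fun x => evalp f x / evalp g x)}.
  apply: continuous_in_subspaceT => x /set_mem /g_gt0 gx.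
  have gx0 : evalp g x != 0 by rewrite gt_eqF.
  exact: (cvgM (@continuous_evalp R n f x)
    (cvgV gx0 (@continuous_evalp R n g x))).
have [x0 /set_mem Kx0 minx0] := EVT_min_rV K0 cK quotc.
(* The set of quotients is nonempty and bounded below, so [inf] is a true infimum, equal to the
   attained minimum. *)
have rhoE : evalp f x0 / evalp g x0 = rho.
  apply/eqP; rewrite eq_le; apply/andP; split.
    apply: lb_le_inf; first by exists (evalp f x0 / evalp g x0), x0.
    by move=> _ [x Kx <-]; exact/minx0/mem_set.
  apply: ge_inf; last by exists x0.
  by exists (evalp f x0 / evalp g x0) => _ [x Kx <-]; exact/minx0/mem_set.
pose T : set 'rV[R]_2 := Umap f g @` K.
have cT : compact T by exact: compact_Umap.
have mu_fin : (mu setT < +oo)%E by exact: Upush_finite.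
have muTC : mu (~` T) = 0%E by exact: Upush_setC_Umap.
have suppT x : K x -> forall V : set 'rV[R]_2,
    open V -> V (Umap f g x) -> (0 < mu V)%E.
  by move=> Kx V oV; exact: Upush_open_gt0.
have mu_gt0 : (0 < mu setT)%E by exact: (suppT _ Kx0 _ openT).
have T0 : T !=set0 by exists (Umap f g x0), x0.
have v_gt0 z : T z -> 0 < evalp (vX R) z.
  by move=> [x Kx <-]; rewrite evalp_vX_Umap g_gt0.
have rho_le z : T z -> rho * evalp (vX R) z <= evalp (uX R) z.
  move=> [x Kx <-]; rewrite evalp_vX_Umap evalp_uX_Umap -ler_pdivlMr ?g_gt0 //.
  by rewrite -rhoE; exact/minx0/mem_set.
have vals := primal_dual_value mu_fin cT muTC mu_gt0 T0 v_gt0 rho_le.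
split.
- by exists x0.
- move=> d; have [a [s [pa av _ ds sa]]] := vals d; exists a; split=> //.
  (* Weak duality for the feasible point [rho] and the optimal [s] yields [rho <= a]. *)
  rewrite -sa; apply: (weak_duality _ _ ds).
    exact: (evalp_integrable mu_fin cT muTC).
  exact: (rho_primal_feasible mu_fin cT muTC rho_le).
- move=> d; have [a [s [pa av dv ds sa]]] := vals d.
  by split; [rewrite /rho_ /a_ av dv|exists s; rewrite /rho_ dv sa].
- split; first exact: (nonincreasing_primal_value mu_fin cT muTC).
  apply: (cvg_primal_value mu_fin cT muTC mu_gt0 T0 v_gt0 rho_le
    (z0 := Umap f g x0)).
  + by exists x0.
  + by rewrite evalp_uX_Umap evalp_vX_Umap -rhoE divfK // gt_eqF // g_gt0.
  + exact: suppT.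
Qed.
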